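(* Let $N$ have the prime decomposition $N=p_1^{n_1}\cdots p_r^{n_r}$ (distinct primes $p_i$, integers $n_i\ge1$). Suppose that there exists an $i\in\{1,\dots,r\}$ such that: 1. there exists no NAR modulo $\gcd(\{p_j-1\}_{j\ne i})$ on $$\{1,(p_i-1),(p_i-1)p_i,\dots,(p_i-1)p_i^{n_i-1}\};$$ 2. there exists no NAR on $$\bigotimes_{j\ne i}\{1,(p_j-1),(p_j-1)p_j,\dots,(p_j-1)p_j^{n_j-1}\}.$$ Then $N$ satisfies the ISAP.
   Context: **ISAP.** For a positive integer $N$ and a set $D$ of divisors $d$ of $N$ with $1\le d<N$, let $ICG_N(D)$ be the graph on vertex set $\mathbb{Z}/N\mathbb{Z}$ in which $i,j$ are adjacent iff $\gcd(i-j,N)\in D$. (These are exactly the integral circulant graphs of order $N$; $D$ is the integral symbol.) The spectrum of a graph is the multiset of eigenvalues of its adjacency matrix. $N$ satisfies the integral spectral Ádám property (ISAP) if for any two such sets $D,D'$, the graphs $ICG_N(D)$ and $ICG_N(D')$ have the same spectrum if and only if $D=D'$. **NAR.** Let $v=(v[x])_{x\in S}$ be a finite family of integers with index set $S$ (multisets are viewed as indexed families, so equal values with different indices are distinguished). A nontrivial additive relation (NAR) on $v$ is a pair of subsets $S_1\neq S_2$ of $S$ (either may be empty) with $\sum_{x\in S_1}v[x]=\sum_{x\in S_2}v[x]$. A NAR modulo $m$ on $v$ is the same with equality replaced by congruence modulo $m$. **Products.** For multisets $S_1,\dots,S_k$, $\bigotimes_{i=1}^k S_i$ is the multiset of the $|S_1|\cdots|S_k|$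 products obtained by choosing one element from each $S_i$ (indexed by the choices; the empty product is $\{1\}$). The gcd of the empty set is $0$, and congruence modulo $0$ is equality. *)

(* Defs.v *)
From mathcomp Require Import all_boot all_order all_algebra all_field.
Set Implicit Arguments.
Unset Strict Implicit.
Unset Printing Implicit Defensive.
Import GRing.Theory Num.Theory.
Local Open Scope ring_scope.

(* An index set of size N is represented by 'I_N (residues 0, ..., N-1) rather
   than 'Z_N, because 'Z_1 is the ring with two elements.  Likewise a set of
   divisors d < N of N is a {set 'I_N} all of whose elements divide N (this
   excludes d = 0 as soon as N > 0). *)
Definition integral_symbol (N : nat) (D : {set 'I_N}) : Prop :=
  forall d : 'I_N, d \in D -> (d %| N)%N.

(* The gcd of the integer difference i - j with N only depends on i - j modulo
   N.  There are no loops: for i = j the gcd is N, which is not in D. *)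
Definition icg (N : nat) (D : {set 'I_N}) : rel 'I_N :=
  fun i j => [exists d in D, gcdz (i%:Z - j%:Z) N%:Z == d%:Z].

Definition adjmx (N : nat) (e : rel 'I_N) : 'M[algC]_N :=
  \matrix_(i, j) (e i j)%:R.

(* Eigenvalues listed with (algebraic) multiplicity, that is, the sequence s
   with char_poly A = \prod_(z <- s) ('X - z%:P); its order is irrelevant, so
   spectra are to be compared with perm_eq. *)
Definition spectrum (N : nat) (A : 'M[algC]_N) : seq algC :=
  sval (closed_field_poly_normal (char_poly A)).

Definition ISAP (N : nat) : Prop :=
  forall D D' : {set 'I_N}, integral_symbol D -> integral_symbol D' ->
    (perm_eq (spectrum (adjmx (icg D))) (spectrum (adjmx (icg D'))) <-> D = D').

Definition has_NAR (S : finType) (v : S -> int) : Prop :=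
  exists S1 S2 : {set S},
    S1 <> S2 /\ \sum_(x in S1) v x = \sum_(x in S2) v x.

(* Since (a %% 0)%Z = a, congruence modulo 0 is equality. *)
Definition has_NAR_mod (m : int) (S : finType) (v : S -> int) : Prop :=
  exists S1 S2 : {set S},
    S1 <> S2 /\ (\sum_(x in S1) v x = \sum_(x in S2) v x %[mod m])%Z.

(* The family 1, p-1, (p-1)p, ..., (p-1)p^(n-1). *)
Definition pp_family (p n : nat) (k : 'I_n.+1) : int :=
  if nat_of_ord k is k'.+1 then (p%:Z - 1) * p%:Z ^+ k' else 1.

(* Indexed by the choice functions; for empty J there is exactly one of them,
   and it yields the family {1}. *)
Definition prod_family (J : finType) (S : J -> finType)
    (v : forall j : J, S j -> int) (f : {dffun forall j : J, S j}) : int :=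
  \prod_(j : J) v j (f j).

(* Main.v *)
Require Import Defs.
From mathcomp Require Import all_boot all_order all_algebra all_field.
Import GRing.Theory Num.Theory.

Local Open Scope ring_scope.

(* Write N = P M with P = p_i^n_i.  The eigenvalues of ICG_N(D) are the values
   lambda_k of the Fourier transform of the indicator of the connection set, and
   lambda_k only depends on gcd(k, N).  Hence a value w has multiplicity
   sum phi(p_i^a) phi(d), over the a and the d | M such that w is the eigenvalue
   at (P / p_i^a) (M / d).  Modulo g = gcd(p_j - 1)_(j <> i) only d = 1
   survives, since g divides phi(d) for all other d; so the first hypothesis makes the
   spectrum determine lambda_k for each multiple k of M.  Fourier inversion on
   Z/P then yields, for each a, the sum of the phi(d) over the d | M such that
   (P / p_i^a) (M / d) is in D, and the second hypothesis recovers these d. *)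

(** * Sums over residues grouped by gcd, and the Chinese remainder theorem *)

Section NatSums.
Local Open Scope nat_scope.

(** The residues counted are the [e * k] with [k < d] coprime to [d]. *)
Lemma sum_gcdn_eq (e d : nat) : 0 < e ->
  \sum_(y < e * d | gcdn y (e * d) == e) 1 = totient d.
Proof.
move=> e0; rewrite totient_count_coprime big_mkord.
have [->|d0] := posnP d; first by rewrite muln0 !big_ord0.
have lt1 (k : 'I_d) : e * k < e * d by rewrite ltn_pmul2l.
have lt2 (y : 'I_(e * d)) : y %/ e < d by rewrite ltn_divLR // [d * e]mulnC.
rewrite (reindex_onto (fun k => Ordinal (lt1 k)) (fun y => Ordinal (lt2 y))).
  rewrite [RHS]big_mkcond [LHS]big_mkcond; apply: eq_bigr => k _ /=.
  rewrite -muln_gcdr -{2}[e]muln1 eqn_pmul2l // gcdnC /coprime.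
  suff -> : Ordinal (lt2 (Ordinal (lt1 k))) == k by rewrite andbT; case: eqP.
  by apply/eqP/val_inj; rewrite /= mulKn.
move=> y /eqP gy; apply: val_inj; rewrite /= mulnC divnK //.
by rewrite -{1}gy dvdn_gcdl.
Qed.

(** The residues are grouped by [d = M %/ gcdn y M], the additive order of [y], rather than by the
    gcd itself: the class of [d] then has exactly [totient d] elements. *)
Lemma sum_gcdn (M : nat) (h : nat -> nat) : 0 < M ->
  \sum_(y < M) h (gcdn y M) =
  \sum_(d < M.+1 | d %| M) totient d * h (M %/ d).
Proof.
move=> M0.
have lt1 (y : 'I_M) : M %/ gcdn y M < M.+1 by rewrite ltnS leq_div.
rewrite (partition_big (fun y => Ordinal (lt1 y))
                       (fun d : 'I_M.+1 => d %| M)) /=; last first.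
  by move=> y _; rewrite dvdn_div // dvdn_gcdr.
apply: eq_bigr => d dM.
have eM : 0 < M %/ d by rewrite divn_gt0 ?(dvdn_gt0 M0) // dvdn_leq.
rewrite -(sum_gcdn_eq (M %/ d)) // big_distrl /= divnK //.
rewrite big_mkcond [RHS]big_mkcond; apply: eq_bigr => y _.
rewrite -val_eqE /= mul1n; set g := gcdn y M.
have gM : g %| M by rewrite dvdn_gcdr.
have -> : (M %/ g == d) = (g == M %/ d).
  apply/eqP/eqP => [<-|->]; by rewrite divnA ?mulKn // ?dvdn_mul.
by case: eqP => // ->.
Qed.

Lemma big_chinese (R : Type) (idx : R) (op : Monoid.com_law idx) (P M : nat)
    (h : nat -> nat -> R) :
  0 < P -> 0 < M -> coprime P M ->
  \big[op/idx]_(s < P * M) h (s %% P) (s %% M) =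
  \big[op/idx]_(x < P) \big[op/idx]_(y < M) h x y.
Proof.
move=> P0 M0 coPM; rewrite pair_bigA /=.
have lt1 (u : 'I_P * 'I_M) : chinese P M u.1 u.2 %% (P * M) < P * M.
  by rewrite ltn_mod muln_gt0 P0.
have ltP (s : 'I_(P * M)) : s %% P < P by rewrite ltn_mod.
have ltM (s : 'I_(P * M)) : s %% M < M by rewrite ltn_mod.
rewrite (reindex_onto (fun u => Ordinal (lt1 u))
                      (fun s => (Ordinal (ltP s), Ordinal (ltM s)))) /=;
  last first.
  by move=> s _; apply: val_inj; rewrite /= -chinese_mod // modn_small.
have eP (u : 'I_P * 'I_M) : chinese P M u.1 u.2 %% (P * M) %% P = u.1.
  by rewrite modn_dvdm ?dvdn_mulr // chinese_modl // modn_small.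
have eM (u : 'I_P * 'I_M) : chinese P M u.1 u.2 %% (P * M) %% M = u.2.
  by rewrite modn_dvdm ?dvdn_mull // chinese_modr // modn_small.
apply: eq_big => [u|u _]; last by rewrite eP eM.
by rewrite /eq_op /= -!val_eqE /= eP eM !eqxx.
Qed.

Lemma sum_dvdn_pfactor (p n : nat) (H : nat -> nat) : prime p ->
  \sum_(d < (p ^ n).+1 | d %| p ^ n) H d = \sum_(a < n.+1) H (p ^ a).
Proof.
move=> pp; have p1 := prime_gt1 pp.
have lt1 (a : 'I_n.+1) : p ^ a < (p ^ n).+1.
  by rewrite ltnS leq_exp2l // -ltnS.
rewrite (reindex_onto (fun a => Ordinal (lt1 a))
                      (fun d => inord (logn p d))) /=.
  apply: eq_bigl => a; rewrite pfactorK // inord_val eqxx andbT.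
  by apply: dvdn_exp2l; rewrite -ltnS.
move=> d /(dvdn_pfactor _ _ pp)[a le_an Ed]; apply: val_inj => /=.
by rewrite Ed pfactorK // inordK.
Qed.

Lemma coprime_bigr (I : finType) (Q : pred I) (F : I -> nat) (m : nat) :
  (forall i, Q i -> coprime m (F i)) -> coprime m (\prod_(i | Q i) F i).
Proof.
move=> coF; elim/big_ind: _ => // [|a b]; first by rewrite coprimen1.
by rewrite coprimeMr => -> ->.
Qed.

Lemma gcdnMr_coprime (k P M : nat) : coprime P M ->
  gcdn k (P * M) = gcdn k P * gcdn k M.
Proof.
move=> coPM; apply/eqP; rewrite eqn_dvd; apply/andP; split; last first.
  rewrite Gauss_dvd; last first.
    by apply: coprime_dvdl (dvdn_gcdr _ _) (coprime_dvdr (dvdn_gcdr _ _) coPM).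
  by rewrite !dvdn_gcd !dvdn_gcdl /= dvdn_mulr ?dvdn_mull // dvdn_gcdr.
have gk := dvdn_gcdl k (P * M); rewrite muln_gcdl !muln_gcdr !dvdn_gcd.
by rewrite dvdn_gcdr !(dvdn_mulr _ gk) (dvdn_mull _ gk).
Qed.

(** * Divisors of a product of distinct prime powers *)

Section Factorizations.
Variables (J : finType) (p n : J -> nat).
Hypotheses (p_prime : forall j, prime (p j)) (p_inj : injective p).

Lemma prod_prime_powers_gt0 (f : J -> nat) : 0 < \prod_j p j ^ f j.
Proof. by apply: prodn_gt0 => j; rewrite expn_gt0 prime_gt0. Qed.

Lemma coprime_prime_powers (f g : J -> nat) (i j : J) :
  i != j -> coprime (p i ^ f i) (p j ^ g j).
Proof.
move=> ne_ij; apply/coprimeXl/coprimeXr.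
by rewrite prime_coprime // dvdn_prime2 // (inj_eq p_inj).
Qed.

Lemma logn_prod_prime_powers (f : J -> nat) (j : J) :
  logn (p j) (\prod_k p k ^ f k) = f j.
Proof.
rewrite (bigD1 j) //= mulnC logn_Gauss ?pfactorK //.
apply: coprime_bigr => k ne_kj; apply: coprimeXr.
by rewrite prime_coprime // dvdn_prime2 // (inj_eq p_inj) eq_sym.
Qed.

Lemma totient_prod_prime_powers (f : J -> nat) :
  totient (\prod_j p j ^ f j) = \prod_j totient (p j ^ f j).
Proof.
rewrite -!big_enum; have: uniq (enum J) := enum_uniq J.
elim: (enum J) => [|j s IHs] /=; first by rewrite !big_nil.
case/andP=> js us; rewrite !big_cons totient_coprime ?IHs // big_seq.
elim/big_ind: _ => [|a b|k ks]; first by rewrite coprimen1.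
  by rewrite coprimeMr => -> ->.
by apply: coprime_prime_powers; apply: contraNneq js => ->.
Qed.

Lemma prod_logn_dvdn (d : nat) : d %| \prod_j p j ^ n j ->
  d = \prod_j p j ^ logn (p j) d.
Proof.
have N0 := prod_prime_powers_gt0 n => dN; have d0 := dvdn_gt0 N0 dN.
apply: eqn_from_log => // [|q]; first exact: prod_prime_powers_gt0.
have [/existsP[j /eqP <-]|qp] := boolP [exists j, p j == q].
  by rewrite logn_prod_prime_powers.
(* No [p j] equals [q], so [q] has valuation 0 in every such product. With exponents [n] this also
   bounds [logn q d] by 0. *)
have q0 (f : J -> nat) : logn q (\prod_j p j ^ f j) = 0.
  have [q_prime|qN] := boolP (prime q); last by rewrite lognE (negPf qN).
  apply: logn_coprime; apply: coprime_bigr => j _; apply: coprimeXr.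
  rewrite prime_coprime // dvdn_prime2 //.
  by apply: contraNneq qp => ->; apply/existsP; exists j.
by apply/eqP; rewrite q0 -leqn0 -(q0 n) dvdn_leq_log.
Qed.

Lemma dvdn_prod_exponents (d : nat) : d %| \prod_j p j ^ n j ->
  exists f : {dffun forall j, 'I_(n j).+1}, d = \prod_j p j ^ f j.
Proof.
move=> dN; have N0 := prod_prime_powers_gt0 n.
exists ([ffun j => inord (logn (p j) d)] : {dffun forall j, 'I_(n j).+1}).
rewrite [LHS]prod_logn_dvdn //; apply: eq_bigr => j _.
rewrite ffunE inordK // ltnS.
by rewrite -(logn_prod_prime_powers n j) dvdn_leq_log.
Qed.

(** By unique factorization the exponent families, which index [prod_family], are in bijection with
    the divisors; valuations give the inverse. *)
Lemma sum_dvdn_prod (H : nat -> nat) :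
  \sum_(d < (\prod_j p j ^ n j).+1 | d %| \prod_j p j ^ n j) H d =
  \sum_(f : {dffun forall j, 'I_(n j).+1}) H (\prod_j p j ^ f j).
Proof.
set N := \prod_j _; have N0 : 0 < N := prod_prime_powers_gt0 n.
have dvdf (f : {dffun forall j, 'I_(n j).+1}) : \prod_j p j ^ f j %| N.
  rewrite /N; apply: (big_ind2 (fun a b => a %| b)) => // [a b c d|j _].
    exact: dvdn_mul.
  by apply: dvdn_exp2l; rewrite -ltnS.
have lt1 (f : {dffun forall j, 'I_(n j).+1}) : \prod_j p j ^ f j < N.+1.
  by rewrite ltnS dvdn_leq.
rewrite (reindex_onto (fun f => Ordinal (lt1 f))
   (fun d => [ffun j => inord (logn (p j) d)] :
             {dffun forall j, 'I_(n j).+1})) /=.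
  apply: eq_bigl => f; rewrite dvdf /=; apply/eqP/ffunP => j.
  by rewrite ffunE logn_prod_prime_powers inord_val.
move=> d dN; apply: val_inj; rewrite /= [RHS]prod_logn_dvdn //.
apply: eq_bigr => j _; rewrite ffunE inordK // ltnS.
by rewrite -(logn_prod_prime_powers n j) dvdn_leq_log.
Qed.

End Factorizations.
End NatSums.

(** * Fourier sums over the residues modulo [N] *)

(** The Fourier coefficient at frequency [k] of the connection set. A predicate [c] on numbers
    stands for the symbol, which frees the sum from the type [{set 'I_N}]. *)
Definition circulant_eig (N : nat) (z : algC) (c : nat -> bool) (k : nat) :=
 
  \sum_(s < N) (c (gcdn s N))%:R * z ^+ (k * s).

Definition fourier_mx (N : nat) (z : algC) : 'M[algC]_N :=
  \matrix_(i, j) z ^+ (i * j).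

Lemma sum_prim_root (N : nat) (z : algC) (k : nat) : N.-primitive_root z ->
  \sum_(s < N) z ^+ (k * s) = if (N %| k)%N then N%:R else 0.
Proof.
move=> zN; under eq_bigr do rewrite exprM.
have [Nk|Nk] := ifP.
  have /eqP-> : z ^+ k == 1 by rewrite -(prim_order_dvd zN).
  by under eq_bigr do rewrite expr1n; rewrite sumr_const card_ord.
have /eqP := subrX1 (z ^+ k) N.
rewrite -exprM [(k * N)%N]mulnC exprM (prim_expr_order zN) expr1n subrr.
by rewrite eq_sym mulf_eq0 subr_eq0 -(prim_order_dvd zN) Nk => /eqP.
Qed.

(** Writing [s = t * d] turns this into the full orthogonality sum for [z ^+ d], a primitive root of
    order [N %/ d]. *)
Lemma sum_prim_root_dvdn (N : nat) (z : algC) (d k : nat) :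
  N.-primitive_root z -> (d %| N)%N ->
  \sum_(s < N | (d %| s)%N) z ^+ (k * s) =
  if (N %/ d %| k)%N then (N %/ d)%:R else 0.
Proof.
move=> zN dN; have N0 := prim_order_gt0 zN; have d0 := dvdn_gt0 N0 dN.
have zNd : (N %/ d).-primitive_root (z ^+ d).
  by have := dvdn_prim_root zN (dvdn_div dN); rewrite divnA ?mulKn.
rewrite -(sum_prim_root _ _ _ zNd).
have lt1 (t : 'I_(N %/ d)) : (t * d < N)%N by rewrite -ltn_divRL.
have lt2 (s : 'I_N) : (s %/ d < N %/ d)%N.
  by rewrite ltn_divRL //; apply: leq_ltn_trans (leq_divM _ _) (ltn_ord s).
rewrite (reindex_onto (fun t => Ordinal (lt1 t)) (fun s => Ordinal (lt2 s))) /=.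
  apply: eq_big => [t|t _]; last by rewrite -exprM [(t * d)%N]mulnC mulnCA.
  by rewrite dvdn_mull //=; apply/eqP/val_inj; rewrite /= mulnK.
by move=> s ds; apply: val_inj; rewrite /= divnK.
Qed.

Lemma ramanujan_sum_gcdn (N : nat) (z : algC) (d k l : nat) :
  N.-primitive_root z -> gcdn k N = gcdn l N -> (d %| N)%N ->
  \sum_(s < N | gcdn s N == d) z ^+ (k * s) =
  \sum_(s < N | gcdn s N == d) z ^+ (l * s).
Proof.
move=> zN eq_kl; have N0 := prim_order_gt0 zN.
(* Moebius inversion: sum_prim_root_dvdn evaluates the sum over all multiples
   of d, and the classes of the larger divisors are known by induction. *)
have [b] := ubnP (N - d); elim: b d => // b IHb d lt_b dN.
have split_d (m : nat) : \sum_(s < N | (d %| s)%N) z ^+ (m * s) =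
    \sum_(s < N | gcdn s N == d) z ^+ (m * s) +
    \sum_(e < N.+1 | [&& (e %| N)%N, (d %| e)%N & e != d :> nat])
      \sum_(s < N | gcdn s N == e) z ^+ (m * s).
  have lt1 (s : 'I_N) : (gcdn s N < N.+1)%N by rewrite ltnS dvdn_leq ?dvdn_gcdr.
  rewrite (bigID (fun s : 'I_N => gcdn s N == d)) /=; congr (_ + _).
    apply: eq_bigl => s; case: eqP => [<-|]; last by rewrite andbF.
    by rewrite dvdn_gcdl.
  rewrite (partition_big (fun s => Ordinal (lt1 s))
    (fun e : 'I_N.+1 => [&& (e %| N)%N, (d %| e)%N & e != d :> nat])) /=.
    apply: eq_bigr => e /and3P[eN de ne]; apply: eq_bigl => s.
    rewrite -val_eqE /=; case: (gcdn s N =P e) => [E|]; last by rewrite andbF.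
    by rewrite E ne !andbT (dvdn_trans de) // -E dvdn_gcdl.
  by move=> s /andP[ds ->]; rewrite dvdn_gcdr dvdn_gcd ds dN.
have := split_d k; rewrite [LHS](sum_prim_root_dvdn _ _ _ _ zN dN).
(* A divisor of [N] divides [k] exactly when it divides [gcdn k N], so the sums over all multiples
   of [d] agree for [k] and [l]. *)
have -> : (N %/ d %| k)%N = (N %/ d %| l)%N.
  by move/(congr1 (dvdn (N %/ d))): eq_kl; rewrite !dvdn_gcd dvdn_div // !andbT.
rewrite -(sum_prim_root_dvdn _ _ _ _ zN dN) split_d.
rewrite [X in _ + X = _](eq_bigr (fun e : 'I_N.+1 =>
   \sum_(s < N | gcdn s N == e) z ^+ (k * s))); first by move/addIr.
move=> e /and3P[eN de ne]; apply/esym/IHb => //.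
apply: leq_trans (_ : (N - d <= b)%N) => //; apply: ltn_sub2l.
  have lt_de : (d < e)%N.
    by rewrite ltn_neqAle eq_sym ne dvdn_leq // (dvdn_gt0 N0).
  by rewrite (leq_trans lt_de) // dvdn_leq.
by rewrite ltn_neqAle eq_sym ne dvdn_leq // (dvdn_gt0 N0).
Qed.

(** Grouping [s] by its gcd with [N] gives a combination of Ramanujan sums, each of which sees the
    frequency only through its gcd with [N]. *)
Lemma circulant_eig_gcdn (N : nat) (z : algC) (c : nat -> bool) (k l : nat) :
  N.-primitive_root z -> gcdn k N = gcdn l N ->
  circulant_eig N z c k = circulant_eig N z c l.
Proof.
move=> zN eq_kl; have N0 := prim_order_gt0 zN.
have E m : circulant_eig N z c m = \sum_(d < N.+1 | (d %| N)%N)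
    (c d)%:R * \sum_(s < N | gcdn s N == d) z ^+ (m * s).
  have lt1 (s : 'I_N) : (gcdn s N < N.+1)%N by rewrite ltnS dvdn_leq ?dvdn_gcdr.
  rewrite /circulant_eig (partition_big (fun s => Ordinal (lt1 s))
    (fun e : 'I_N.+1 => (e %| N)%N)) /=; last by move=> s _; rewrite dvdn_gcdr.
  apply: eq_bigr => d _; rewrite big_distrr /=.
  by apply: eq_big => [s|s /eqP <-] //.
by rewrite !E; apply: eq_bigr => d dN;
   rewrite (ramanujan_sum_gcdn _ _ _ _ _ zN eq_kl).
Qed.

(** This is a Vandermonde matrix, with distinct nodes since [z] is primitive. *)
Lemma fourier_mx_unit (N : nat) (z : algC) :
  N.-primitive_root z -> fourier_mx N z \in unitmx.
Proof.
move=> zN; have -> : fourier_mx N z = Vandermonde N (\row_j z ^+ j).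
  by apply/matrixP => i j; rewrite !mxE mulnC exprM.
rewrite unitmxE det_Vandermonde unitfE.
apply/prodf_neq0 => i _; apply/prodf_neq0 => j lt_ij.
rewrite !mxE subr_eq0 (eq_prim_root_expr zN) !modn_small //.
by rewrite neq_ltn lt_ij orbT.
Qed.

(** Both sides are entries of a row vector times the invertible Fourier matrix, and natural numbers
    embed in [algC]. *)
Lemma fourier_inj (N : nat) (z : algC) (F F' : nat -> nat) :
  N.-primitive_root z ->
  (forall k, (k < N)%N -> \sum_(t < N) (F t)%:R * z ^+ (k * t) =
                          \sum_(t < N) (F' t)%:R * z ^+ (k * t)) ->
  forall t, (t < N)%N -> F t = F' t.
Proof.
move=> zN eqF t lt_t.
have E (G : nat -> nat) :
    (\row_(t < N) (G t)%:R : 'rV[algC]_N) *m fourier_mx N z =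
    \row_(k < N) \sum_(t < N) (G t)%:R * z ^+ (k * t).
  by apply/rowP => k; rewrite !mxE; apply: eq_bigr => s _; rewrite !mxE mulnC.
have: (\row_(t < N) (F t)%:R : 'rV[algC]_N) *m fourier_mx N z =
      (\row_(t < N) (F' t)%:R) *m fourier_mx N z.
  by rewrite !E; apply/rowP => k; rewrite !mxE eqF.
move/(can_inj (mulmxK (fourier_mx_unit _ _ zN)))/rowP/(_ (Ordinal lt_t)).
by rewrite !mxE => /eqP; rewrite eqr_nat => /eqP.
Qed.

(** * Spectra of integral circulant graphs *)

Lemma similar_char_poly (F : fieldType) (n : nat) (A B V : 'M[F]_n) :
  V \in unitmx -> A *m V = V *m B -> char_poly A = char_poly B.
Proof.
move=> uV eqAV.
have /(congr1 determinant) : char_poly_mx A *m map_mx polyC V =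
                             map_mx polyC V *m char_poly_mx B.
  by rewrite /char_poly_mx mulmxBl mulmxBr -!map_mxM eqAV scalar_mxC.
rewrite !det_mulmx mulrC => /mulfI; apply.
by rewrite det_map_mx polyC_eq0 -unitfE -unitmxE.
Qed.

Lemma spectrumP (N : nat) (A : 'M[algC]_N) :
  char_poly A = \prod_(w <- spectrum A) ('X - w%:P).
Proof.
rewrite /spectrum; case: closed_field_poly_normal => s /= {1}->.
by rewrite (monicP (char_poly_monic A)) scale1r.
Qed.

(** Membership by value can be tested at every gcd, including [N] itself, which is no element of
    ['I_N] and yields false. *)
Definition mem_nat (N : nat) (D : {set 'I_N}) (d : nat) : bool :=
  [exists x in D, x == d :> nat].

Lemma icgE (N : nat) (D : {set 'I_N}) (i s : 'I_N)
    (lt_s : ((i + s) %% N < N)%N) :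
  icg D i (Ordinal lt_s) = mem_nat N D (gcdn s N).
Proof.
(* The difference is [- s] up to a multiple of [N], so it has the same gcd with [N] as [s]. *)
have E : i%:Z - ((i + s) %% N)%N%:Z = ((i + s) %/ N)%N%:Z * N%:Z - s%:Z.
  by apply/eqP; rewrite subr_eq addrAC eq_sym subr_eq -PoszM -!PoszD -divn_eq.
rewrite /icg /mem_nat; apply: eq_existsb => x; congr (_ && _).
by rewrite /= E gcdzC gcdzMDl gcdzN gcdzC eq_sym.
Qed.

(** The columns of the Fourier matrix are eigenvectors: substituting [j = i + s] modulo [N] in row
    [i] factors out [z ^+ (i * k)]. *)
Lemma adjmx_icg_fourier (N : nat) (z : algC) (D : {set 'I_N}) :
  N.-primitive_root z ->
  adjmx (icg D) *m fourier_mx N z =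
  fourier_mx N z *m diag_mx (\row_k circulant_eig N z (mem_nat N D) k).
Proof.
move=> zN; have N0 := prim_order_gt0 zN.
rewrite mul_mx_diag; apply/matrixP => i k; rewrite !mxE big_distrr /=.
have lt1 (s : 'I_N) : ((i + s) %% N < N)%N by rewrite ltn_mod.
(* Adding [N - i] plays the part of subtracting [i] modulo [N]. *)
have lt2 (j : 'I_N) : ((j + (N - i)) %% N < N)%N by rewrite ltn_mod.
rewrite (reindex_onto (fun s => Ordinal (lt1 s)) (fun j => Ordinal (lt2 j))) /=.
  apply: eq_big => [s|s _].
    apply/eqP/val_inj; rewrite /= modnDml addnAC subnKC 1?ltnW //.
    by rewrite modnDl modn_small.
  rewrite !mxE icgE mulrCA; congr (_ * _).
  apply/eqP; rewrite -exprD (eq_prim_root_expr zN) /=.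
  by rewrite -modnMml modn_mod modnMml mulnDl [(k * s)%N]mulnC.
move=> j _; apply: val_inj; rewrite /= modnDmr addnCA subnKC 1?ltnW //.
by rewrite modnDr modn_small.
Qed.

Lemma perm_spectrum_icg (N : nat) (z : algC) (D : {set 'I_N}) :
  N.-primitive_root z ->
  perm_eq (spectrum (adjmx (icg D)))
          [seq circulant_eig N z (mem_nat N D) k | k : 'I_N].
Proof.
move=> zN; apply: prod_XsubC_eq; rewrite -spectrumP.
rewrite (similar_char_poly _ _ _ _ _ (fourier_mx_unit _ _ zN)
           (adjmx_icg_fourier _ _ D zN)).
rewrite char_poly_trig ?diag_mx_is_trig // big_image.
by apply: eq_bigr => i _; rewrite !mxE eqxx.
Qed.

Lemma cospectral_icg_count (N : nat) (z : algC) (D D' : {set 'I_N}) (w : algC) :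
  N.-primitive_root z ->
  perm_eq (spectrum (adjmx (icg D))) (spectrum (adjmx (icg D'))) ->
  (\sum_(k < N) (circulant_eig N z (mem_nat N D) k == w) =
   \sum_(k < N) (circulant_eig N z (mem_nat N D') k == w))%N.
Proof.
move=> zN eqDD'.
have E (D1 : {set 'I_N}) :
    (\sum_(k < N) (circulant_eig N z (mem_nat N D1) k == w))%N =
    count_mem w (spectrum (adjmx (icg D1))).
  rewrite (permP (perm_spectrum_icg _ _ D1 zN)) count_map -sum1_count.
  rewrite big_enum_cond [RHS]big_mkcond; apply: eq_bigr => k _ /=.
  by case: (_ == w).
by rewrite !E (permP eqDD').
Qed.

(** * The two families as totients of divisors *)

Lemma pp_familyE (p n : nat) (k : 'I_n.+1) : prime p ->
  pp_family p k = (totient (p ^ k))%:Z.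
Proof.
move=> pp; rewrite /pp_family; case: (nat_of_ord k) => [|a]; first by [].
by rewrite totient_pfactor //= PoszM -subn1 -subzn ?prime_gt0 // -!rmorphXn.
Qed.

Lemma prod_familyE (J : finType) (q m : J -> nat)
    (f : {dffun forall j, 'I_(m j).+1}) :
  (forall j, prime (q j)) -> injective q ->
  prod_family (fun j => @pp_family (q j) (m j)) f =
  (totient (\prod_j q j ^ f j))%:Z.
Proof.
move=> q_prime q_inj; rewrite totient_prod_prime_powers // /prod_family.
rewrite (big_morph Posz PoszM (erefl 1)).
by apply: eq_bigr => j _; rewrite pp_familyE.
Qed.

(** Some [q j] divides [d], and its power in [d] contributes the factor [q j - 1] to the totient. *)
Lemma dvdn_totient_prod (J : finType) (q m : J -> nat) (g d : nat) :
  (forall j, prime (q j)) -> injective q -> (forall j, (g %| q j - 1)%N) ->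
  (d %| \prod_j q j ^ m j)%N -> d != 1%N -> (g %| totient d)%N.
Proof.
move=> q_prime q_inj gq dM d1.
have Ed := prod_logn_dvdn _ _ _ q_prime q_inj _ dM.
have [/existsP[j jd]|d0] := boolP [exists j, logn (q j) d != 0%N]; last first.
  case/eqP: d1; rewrite Ed; apply: big1 => j _.
  by move: d0; rewrite negb_exists => /forallP/(_ j); rewrite negbK => /eqP->.
rewrite Ed totient_prod_prime_powers // (bigD1 j) //= dvdn_mulr //.
by rewrite totient_pfactor ?lt0n // dvdn_mulr // -subn1.
Qed.

(** * Recovering the symbol from the eigenvalue multiplicities *)

Section NoNAR.
Variables (p n : nat) (J : finType) (q m : J -> nat) (g : nat).
Hypotheses (p_prime : prime p) (q_prime : forall j, prime (q j)).
Hypotheses (q_inj : injective q) (neq_pq : forall j, p != q j).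
Hypothesis dvd_g : forall j, (g %| q j - 1)%N.
Hypothesis no_NAR_mod : ~ has_NAR_mod g%:Z (@pp_family p n).
Hypothesis no_NAR :
  ~ has_NAR (prod_family (fun j : J => @pp_family (q j) (m j))).

Local Notation P := (p ^ n)%N.
Local Notation M := (\prod_j q j ^ m j)%N.

Let P_gt0 : (0 < P)%N. Proof. by rewrite expn_gt0 prime_gt0. Qed.
Let M_gt0 : (0 < M)%N. Proof. exact: prod_prime_powers_gt0. Qed.
Let coprimePM : coprime P M.
Proof.
apply: coprime_bigr => j _; apply/coprimeXl/coprimeXr.
by rewrite prime_coprime // dvdn_prime2.
Qed.

Variables (z : algC) (zN : (P * M).-primitive_root z).

Let gcdnPM k : gcdn k (P * M) = (gcdn (k %% P) P * gcdn (k %% M) M)%N.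
Proof. by rewrite gcdnMr_coprime // !gcdn_modl. Qed.

Local Notation eig := (circulant_eig (P * M) z).

Lemma eig_count_mod (c : nat -> bool) (w : algC) :
  (\sum_(k < P * M) (eig c k == w) =
   \sum_(a < n.+1) totient (p ^ a) * (eig c (P %/ p ^ a * M) == w) %[mod g])%N.
Proof.
pose h x y : nat := eig c (x * y)%N == w.
have -> : (\sum_(k < P * M) (eig c k == w) =
    \sum_(k < P * M) h (gcdn (k %% P) P) (gcdn (k %% M) M))%N.
  apply: eq_bigr => k _; rewrite /h -gcdnPM.
  by rewrite (circulant_eig_gcdn _ _ _ _ (gcdn k (P * M)) zN) // -gcdnA gcdnn.
(* The two residues now vary independently, and each is grouped by its own gcd. *)
rewrite (big_chinese _ _ _ _ _ (fun x y => h (gcdn x P) (gcdn y M))) //.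
rewrite (sum_gcdn _ (fun x => \sum_(y < M) h x (gcdn y M))%N) //.
rewrite (sum_dvdn_pfactor p n (fun d => totient d *
   \sum_(y < M) h (P %/ d) (gcdn y M))%N) //.
apply: (big_ind2 (fun x y => x = y %[mod g])%N) => // [x1 x2 y1 y2 E1 E2|a _].
  by rewrite -modnDm E1 E2 modnDm.
rewrite -modnMmr -[RHS]modnMmr; congr ((_ * _) %% _)%N.
rewrite (sum_gcdn _ (h (P %/ p ^ a)%N)) //.
have lt1 : (1 < M.+1)%N by rewrite ltnS.
(* The divisor [d = 1] has totient 1 and stands for the gcd [M %/ 1 = M]; every other term vanishes
   modulo [g]. *)
rewrite (bigD1 (Ordinal lt1)) ?dvd1n //= divn1 mul1n.
set rest := (\sum_(d < _ | _) _)%N; suff: (g %| rest)%N.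
  by move=> /eqP g_rest; rewrite -modnDmr g_rest addn0.
apply: dvdn_sum => d /andP[dM d1]; apply: dvdn_mulr.
exact: (dvdn_totient_prod _ q m).
Qed.

Variables c c' : nat -> bool.
Hypothesis eq_count : forall w,
  (\sum_(k < P * M) (eig c k == w) = \sum_(k < P * M) (eig c' k == w))%N.

(** Let [w] be the left-hand value. The sums of [pp_family] over the exponents where [c],
    respectively [c'], gives [w] are congruent modulo [g] to the multiplicities of [w], which are
    equal. Hence the two exponent sets coincide, and [a] lies in the first by the choice of [w]. *)
Lemma eq_eig_pfactor (a : 'I_n.+1) :
  eig c (P %/ p ^ a * M)%N = eig c' (P %/ p ^ a * M)%N.
Proof.
set w := LHS; pose S c1 := [set b : 'I_n.+1 | eig c1 (P %/ p ^ b * M)%N == w].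
have sumS c1 : \sum_(b in S c1) pp_family p b =
    (\sum_(b < n.+1) totient (p ^ b) * (eig c1 (P %/ p ^ b * M) == w))%N%:Z.
  rewrite (big_morph Posz PoszD (erefl 0)) big_mkcond; apply: eq_bigr => b _.
  by rewrite inE pp_familyE //; case: (_ == w); rewrite ?muln1 ?muln0.
have eqS : S c = S c'.
  apply/eqP/negPn/negP => /eqP neqS; apply: no_NAR_mod; exists (S c), (S c').
  by split; rewrite // !sumS !modz_nat -!eig_count_mod eq_count.
have: a \in S c by rewrite inE.
by rewrite eqS inE => /eqP.
Qed.

Lemma eq_eig_multiple (k : nat) : eig c (M * k)%N = eig c' (M * k)%N.
Proof.
have /(dvdn_pfactor _ _ p_prime)[b le_bn Eb] := dvdn_gcdr k P.
(* The preceding lemma indexes by the complementary divisor, so the gcd [p ^ b] corresponds to the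
   exponent [n - b]. *)
have Ea : (p ^ b = P %/ p ^ (Ordinal (leq_subr b n : (n - b < n.+1)%N)))%N.
  by rewrite /= -{1}(subnK le_bn) expnD mulKn // expn_gt0 prime_gt0.
have E c1 : eig c1 (M * k)%N = eig c1 (gcdn k P * M)%N.
  apply: (circulant_eig_gcdn _ _ _ _ _ zN).
  by rewrite mulnC -!muln_gcdl -gcdnA gcdnn.
by rewrite !E Eb Ea eq_eig_pfactor.
Qed.

(** At a frequency [M * k] the character sees only [s] modulo [P]. The eigenvalue is thus the
    Fourier transform on residues modulo [P] of these class sums, and [fourier_inj] applies. *)
Lemma eq_class_sum (t : nat) : (t < P)%N ->
  (\sum_(y < M) c (gcdn t P * gcdn y M) =
   \sum_(y < M) c' (gcdn t P * gcdn y M))%N.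
Proof.
have zP : P.-primitive_root (z ^+ M).
  by have := dvdn_prim_root zN (dvdn_mulr M (dvdnn P)); rewrite mulKn.
pose F (c1 : nat -> bool) t := (\sum_(y < M) c1 (gcdn t P * gcdn y M))%N.
have E (c1 : nat -> bool) k :
    \sum_(t < P) (F c1 t)%:R * (z ^+ M) ^+ (k * t) = eig c1 (M * k)%N.
  pose h x y := (c1 (gcdn x P * gcdn y M)%N : nat)%:R * z ^+ (M * k * x) : algC.
  transitivity (\sum_(s < P * M) h (s %% P)%N (s %% M)%N).
    rewrite big_chinese //; apply: eq_bigr => x _.
    rewrite natr_sum big_distrl /=; apply: eq_bigr => y _.
    by rewrite /h -exprM mulnA.
  apply: eq_bigr => s _; rewrite /h gcdnPM; congr (_ * _).
  (* Exponents count modulo [P * M], and the factor [M] leaves [s] to be known modulo [P] only. *)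
  apply/eqP; rewrite (eq_prim_root_expr zN) -!mulnA.
  move: (nat_of_ord s) => u; rewrite [(P * M)%N]mulnC.
  by rewrite -!muln_modr; apply/eqP; congr (_ * _)%N; rewrite modnMmr.
apply: (fourier_inj P (z ^+ M) (F c) (F c') zP) => k _.
by rewrite !E eq_eig_multiple.
Qed.

(** With the gcd with [P] fixed, each class sum is the sum of [prod_family] over the complementary
    divisors of [M] that the predicate selects. Equal sums without a NAR force equal selections. *)
Lemma eq_symbol (d : nat) : (d %| P * M)%N -> c d = c' d.
Proof.
move=> dN; pose Mf (f : {dffun forall j, 'I_(m j).+1}) := (\prod_j q j ^ f j)%N.
pose S (c1 : nat -> bool) := [set f | c1 (gcdn d P * (M %/ Mf f))%N].
have sumS c1 :
    \sum_(f in S c1) prod_family (fun j => @pp_family (q j) (m j)) f =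
    (\sum_(y < M) c1 (gcdn (gcdn d P) P * gcdn y M))%N%:Z.
  rewrite (sum_gcdn _ (fun e => c1 (gcdn (gcdn d P) P * e)%N)) //.
  rewrite (sum_dvdn_prod _ q m q_prime q_inj (fun e =>
    totient e * c1 (gcdn (gcdn d P) P * (M %/ e)))%N).
  rewrite (big_morph Posz PoszD (erefl 0)) big_mkcond; apply: eq_bigr => f _.
  rewrite inE prod_familyE // -gcdnA gcdnn.
  by case: (c1 _); rewrite ?muln1 ?muln0.
have eq_sum : (\sum_(y < M) c (gcdn (gcdn d P) P * gcdn y M) =
               \sum_(y < M) c' (gcdn (gcdn d P) P * gcdn y M))%N.
  (* Reducing [d] modulo [P] meets the bound on [t] and keeps the gcd with [P]. *)
  have := eq_class_sum (d %% P)%N; rewrite ltn_mod gcdn_modl -gcdnA gcdnn.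
  exact.
have eqS : S c = S c'.
  apply/eqP/negPn/negP => /eqP neqS; apply: no_NAR; exists (S c), (S c').
  by rewrite !sumS eq_sum.
have eM : (M %/ gcdn d M %| M)%N by rewrite dvdn_div ?dvdn_gcdr.
(* [f] holds the exponents of [M %/ gcdn d M], so [M %/ Mf f] is [gcdn d M]. *)
have [f Ef] := dvdn_prod_exponents _ q m q_prime q_inj _ eM.
have Ed : d = (gcdn d P * (M %/ Mf f))%N.
  rewrite /Mf -Ef divnA ?dvdn_gcdr // mulKn // -gcdnMr_coprime //.
  by apply/esym/gcdn_idPl.
by rewrite Ed; have /setP/(_ f) := eqS; rewrite !inE.
Qed.

End NoNAR.

Theorem theorem5p5 (N r : nat) (p n : 'I_r -> nat)
    (p_prime : forall i : 'I_r, prime (p i))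
    (p_inj : injective p)
    (n_ge1 : forall i : 'I_r, (1 <= n i)%N)
    (N_decomp : N = (\prod_(i < r) p i ^ n i)%N)
    (no_NARs : exists i : 'I_r,
      ~ has_NAR_mod (\big[gcdn/0]_(j < r | j != i) (p j - 1))%N
          (@pp_family (p i) (n i))
      /\
      ~ has_NAR
          (@prod_family {j : 'I_r | j != i}
             (fun j => 'I_(n (val j)).+1)
             (fun j => @pp_family (p (val j)) (n (val j))))) :
  ISAP N.
Proof.
have [i [no_NAR_mod no_NAR]] := no_NARs => D D' symD symD'.
split=> [cospectral|-> //].
pose q (j : {j : 'I_r | j != i}) := p (val j).
pose m (j : {j : 'I_r | j != i}) := n (val j).
have EN : N = (p i ^ n i * \prod_j q j ^ m j)%N.
  rewrite N_decomp (bigD1 i) //=; congr (_ * _)%N.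
  rewrite (reindex_omap val (insub : 'I_r -> option {j : 'I_r | j != i})) /=.
    by apply: eq_bigl => j; rewrite valK eqxx (valP j).
  by move=> j ji; rewrite insubT.
have N0 : (0 < N)%N by rewrite N_decomp prod_prime_powers_gt0.
have [z zN] := C_prim_root_exists N0.
have q_inj : injective q by move=> j k /p_inj/val_inj.
have neq_pq j : p i != q j by rewrite (inj_eq p_inj) eq_sym (valP j).
(* For [r = 1] there is no such [j]; the gcd is 0 and congruence modulo it is equality. *)
have dvd_g j : (\big[gcdn/0]_(j < r | j != i) (p j - 1) %| q j - 1)%N.
  by rewrite (bigD1 (val j)) ?(valP j) //= dvdn_gcdl.
have eq_mem d : (d %| N)%N -> mem_nat N D d = mem_nat N D' d.
  have := fun w => cospectral_icg_count N z D D' w zN cospectral.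
  (* The types of [D] and [D'] mention [N]; generalizing their predicates allows [N] to be rewritten
     as the product. *)
  move: (mem_nat N D) (mem_nat N D') zN; rewrite EN => c c' zN eq_count.
  exact: (eq_symbol (p i) (n i) _ q m _ (p_prime i)
            (fun j => p_prime (val j)) q_inj neq_pq dvd_g
            no_NAR_mod no_NAR z zN c c' eq_count d).
have mem_natE (D1 : {set 'I_N}) (x : 'I_N) : mem_nat N D1 x = (x \in D1).
  apply/existsP/idP => [[y /andP[yD /eqP/val_inj <-]] //|xD].
  by exists x; rewrite xD eqxx.
apply/setP => x; rewrite -!mem_natE.
(* A non-divisor of [N] lies in neither symbol. *)
have [xN|xN] := boolP (x %| N)%N; first exact: eq_mem.
by rewrite !mem_natE; apply/idP/idP => [/symD|/symD']; rewrite (negPf xN).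
Qed.
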